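(* For every integer $k\ge 3$, there exist two nonnegative smooth functions $f,g\in L^1(\mathbb{R})$ that have the same $k$-deck, $N_f=N_g$, but are not translates of each other (there is no $a\in\mathbb{R}$ with $g(x)=f(x-a)$ for almost every $x\in\mathbb{R}$).
   Context: For an integer $k\ge 3$ and a nonnegative $f\in L^1(\mathbb{R})$, the $k$-deck of $f$ is the function on $\mathbb{R}^{k-1}$ given by $N_f(x_1,\ldots,x_{k-1})=\int_{\mathbb{R}} f(t)f(t+x_1)\cdots f(t+x_{k-1})\,dt$. Equality of $k$-decks means equality almost everywhere on $\mathbb{R}^{k-1}$. *)

(* Defs.v *)
From HB Require Import structures.
From mathcomp Require Import all_boot all_order all_algebra.
From mathcomp Require Import all_classical all_reals all_analysis.

Set Implicit Arguments.
Unset Strict Implicit.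
Unset Printing Implicit Defensive.

Import Order.TTheory GRing.Theory Num.Theory.
Import numFieldNormedType.Exports.

Local Open Scope classical_set_scope.
Local Open Scope ring_scope.
Local Open Scope ereal_scope.

Section cons_product_measure.
Context d (T : measurableType d) (R : realType) (n : nat).

Definition tuple_cons (p : T * n.-tuple T) : n.+1.-tuple T :=
  [tuple of p.1 :: p.2].

Let tuple_uncons (t : n.+1.-tuple T) : T * n.-tuple T :=
  (thead t, [tuple of behead t]).

Let tuple_consK : cancel tuple_cons tuple_uncons.
Proof. by move=> [a b]; rewrite /tuple_uncons theadE; congr pair; apply/val_inj. Qed.

Lemma measurable_tuple_cons : measurable_fun setT tuple_cons.
Proof. exact: (measurable_cons measurable_fst measurable_snd). Qed.

Let measurable_tuple_uncons : measurable_fun setT tuple_uncons.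
Proof.
apply: measurable_fun_pair; first exact: (measurable_tnth ord0).
exact: measurable_behead.
Qed.

Definition cons_product (m1 : set T -> \bar R) (m2 : set (n.-tuple T) -> \bar R)
  : set (n.+1.-tuple T) -> \bar R := pushforward (m1 \x m2) tuple_cons.

Variables (m1 : {sigma_finite_measure set T -> \bar R})
  (m2 : {sigma_finite_measure set (n.-tuple T) -> \bar R}).

Let cons_product0 : cons_product m1 m2 set0 = 0.
Proof. by rewrite /cons_product /pushforward preimage_set0 measure0. Qed.

Let cons_product_ge0 A : 0 <= cons_product m1 m2 A.
Proof. by rewrite /cons_product /pushforward; exact: (@measure_ge0 _ _ _ (m1 \x m2)). Qed.

Let cons_product_sigma_additive : semi_sigma_additive (cons_product m1 m2).
Proof.
move=> F mF tF mUF; rewrite /cons_product /pushforward preimage_bigcup.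
have mcons A : measurable A -> measurable (tuple_cons @^-1` A).
  by move=> mA; rewrite -[X in measurable X]setTI; exact: measurable_tuple_cons.
apply: measure_semi_sigma_additive.
- by move=> k; exact: mcons.
- apply/trivIsetP => /= i j _ _ ij; rewrite -preimage_setI.
  by move/trivIsetP : tF => /(_ _ _ _ _ ij) ->//; rewrite preimage_set0.
- by rewrite -preimage_bigcup; exact: mcons.
Qed.

HB.instance Definition _ := isMeasure.Build _ _ _ (cons_product m1 m2)
  cons_product0 cons_product_ge0 cons_product_sigma_additive.

Let cons_product_sigma_finite : sigma_finite setT (cons_product m1 m2).
Proof.
have /sigma_finiteP[F [TF ndF Foo]] := sigma_finiteT m1.
have /sigma_finiteP[G [TG ndG Goo]] := sigma_finiteT m2.
exists (fun k => tuple_uncons @^-1` (F k `*` G k)).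
- rewrite -preimage_bigcup (_ : \bigcup_k _ = setT) ?preimage_setT//.
  apply/seteqP; split=> // -[x y] _.
  have [i _ Fx] : (\bigcup_i F i) x by rewrite -TF.
  have [j _ Gy] : (\bigcup_i G i) y by rewrite -TG.
  exists (maxn i j) => //; split => /=.
  + by move: Fx; exact/subsetPset/ndF/leq_maxl.
  + by move: Gy; exact/subsetPset/ndG/leq_maxr.
- move=> k; have [mF Fk] := Foo k; have [mG Gk] := Goo k.
  split.
  + rewrite -[X in measurable X]setTI; apply: measurable_tuple_uncons => //.
    exact: measurableX.
  + rewrite /cons_product /pushforward -comp_preimage.
    rewrite (_ : _ \o _ = id) ?preimage_id; last exact/funext/tuple_consK.
    by rewrite product_measure1E// lte_mul_pinfty// ge0_fin_numE.
Qed.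

HB.instance Definition _ := Measure_isSigmaFinite.Build _ _ _
  (cons_product m1 m2) cons_product_sigma_finite.

End cons_product_measure.

Section lebesgue_tuple.
Context (R : realType).
Local Notation T := (measurableTypeR R).

(* Lebesgue measure on R^n: [n.-tuple R] carries the product sigma-algebra and
   the library has no product measure on it. *)
Fixpoint lebesgue_tuple (n : nat) :
    {sigma_finite_measure set (n.-tuple T) -> \bar R} :=
  match n with
  | 0%N => \d_([tuple] : 0.-tuple T)
  | m.+1 => cons_product (@lebesgue_measure R) (lebesgue_tuple m)
  end.

Lemma lebesgue_tuple_box (n : nat) (A : 'I_n -> set T) :
  (forall i, measurable (A i)) ->
  lebesgue_tuple n [set t | forall i, A i (tnth t i)] =
  \prod_(i < n) lebesgue_measure (A i).
Proof.
elim: n A => [|n IH] A mA.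
  rewrite big_ord0 /= diracE (_ : _ \in _ = true)//.
  by apply/mem_set => -[].
rewrite big_ord_recl -IH// /= /cons_product /pushforward.
have -> : @tuple_cons _ T n @^-1` [set t | forall i, A i (tnth t i)] =
    A ord0 `*` [set t | forall i, A (lift ord0 i) (tnth t i)].
  apply/seteqP; split=> -[a b] /=.
  - move=> Aab; split; first exact: (Aab ord0).
    by move=> i; have := Aab (lift ord0 i); rewrite tnthS.
  - by move=> [Aa Ab] i; case: (unliftP ord0 i) => [j ->|->//]; rewrite tnthS.
rewrite product_measure1E//.
rewrite (_ : [set t | _] =
    \bigcap_(i in setT) ((@tnth _ T ^~ i) @^-1` A (lift ord0 i))).
  apply: fin_bigcap_measurable => // i _; rewrite -[X in measurable X]setTI.
  exact: measurable_tnth.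
by apply/seteqP; split=> t /= H i => [_|]; exact: H.
Qed.

End lebesgue_tuple.

Local Open Scope ring_scope.

Definition smooth (R : realType) (f : R -> R) : Prop :=
  forall (n : nat) (x : R), derivable (f^`(n))%classic x 1.

(* The value is in [\bar R]: for f >= 0 in L^1 the integral always makes sense,
   but is only finite for almost every x. *)
Definition k_deck (R : realType) (k : nat) (f : R -> R)
    (x : (k.-1).-tuple (measurableTypeR R)) : \bar R :=
  \int[@lebesgue_measure R]_t (f t * \prod_(i < k.-1) f (t + tnth x i))%:E.

Definition is_translate (R : realType) (f g : R -> R) : Prop :=
  exists a : R, {ae @lebesgue_measure R, forall x, g x = f (x - a)}.

(* Main.v *)
(* Multiply the nonnegative band-limited function phi(t) = (sin t / t)^2 by
   1 + cos(M t + th).  In the k-deck, the product of the k modulating factors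
   is a trigonometric polynomial in M t + th, and each term of nonzero
   frequency m M is integrated against a product of k translates of phi.  That
   product has its spectrum in [-2k, 2k], so for M large these integrals vanish
   and the deck does not depend on th.  Being band-limited is used in the
   following real-variable form: if |h^(n)| <= s^n w for all n, with w
   integrable, then n integrations by parts bound the integral of
   h(t) cos(l t + b) by (s / l)^n times the integral of w, hence it is 0 for
   s < l.  The phases 0 and pi give two even functions with distinct values at
   0; a translation by a relating them would make both 2a-periodic, which
   contradicts their decay. *)
Require Import Defs.
From mathcomp Require Import all_boot all_order all_algebra.
From mathcomp Require Import all_classical all_reals all_analysis.
From mathcomp Require Import measurable_realfun zify ring lra.

Import Order.TTheory GRing.Theory Num.Theory.
Import numFieldNormedType.Exports.

Local Open Scope classical_set_scope.
Local Open Scope ring_scope.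

Set Implicit Arguments.
Unset Strict Implicit.
Unset Printing Implicit Defensive.

(* [tame n s w h]: |h^(i)| <= s^i w for i <= n.  For all n at once this replaces
   "the Fourier transform of [h] is supported in [-s, s]". *)
Fixpoint tame {R : realType} (n : nat) (s : R) (w h : R -> R) : Prop :=
  (forall x, `|h x| <= w x) /\
  match n with
  | 0%N => continuous h
  | m.+1 => exists2 h' : R -> R, (forall x : R, is_derive x (1 : R) h (h' x)) &
                                 tame m s (fun x => s * w x) h'
  end.

(** * Calculus of functions whose derivatives grow geometrically *)

Section tame_algebra.
Context {R : realType}.
Implicit Types (n : nat) (s : R) (w h : R -> R).

Lemma tame_le n s w h : tame n s w h -> forall x, `|h x| <= w x.
Proof. by case: n => [|n] []. Qed.

Lemma tame_ge0 n s w h : tame n s w h -> forall x, 0 <= w x.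
Proof. by move=> hw x; rewrite (le_trans _ (tame_le hw x)). Qed.

Lemma is_derive_continuous (f f' : R -> R) :
  (forall x : R, is_derive x (1 : R) f (f' x)) -> continuous f.
Proof.
by move=> df x; apply/differentiable_continuous/derivable1_diffP.
Qed.

Lemma is_derive_mul (f g : R -> R) (x df dg : R) :
  is_derive x 1 f df -> is_derive x 1 g dg ->
  is_derive x 1 (fun t => f t * g t) (f x * dg + g x * df).
Proof. by move=> df' dg'; have H := is_deriveM df' dg'; exact H. Qed.

Lemma tame_continuous n s w h : tame n s w h -> continuous h.
Proof. by case: n => [[]//|n [_ [h' dh _]]]; exact: is_derive_continuous dh. Qed.

Lemma tameW n s w h : tame n.+1 s w h -> tame n s w h.
Proof.
elim: n w h => [|n IH] w h.
  by move=> hw; split; [exact: tame_le hw|exact: tame_continuous hw].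
by move=> [hw [h' dh th']]; split => //; exists h' => //; exact: IH.
Qed.

Lemma tame_weaken n s s' w w' h : 0 <= s <= s' -> (forall x, w x <= w' x) ->
  tame n s w h -> tame n s' w' h.
Proof.
move=> /andP[s0 ss']; elim: n w w' h => [|n IH] w w' h ww' hw.
  split; last exact: tame_continuous hw.
  by move=> x; apply: le_trans (tame_le hw x) _.
have w0 := tame_ge0 hw.
case: hw => hw [h' dh th']; split; first by move=> x; apply: le_trans (hw x) _.
by exists h' => //; apply: IH th' => x; rewrite ler_pM.
Qed.

Lemma tameD n s w1 w2 h1 h2 : tame n s w1 h1 -> tame n s w2 h2 ->
  tame n s (fun x => w1 x + w2 x) (fun x => h1 x + h2 x).
Proof.
elim: n w1 w2 h1 h2 => [|n IH] w1 w2 h1 h2 [hw1 H1] [hw2 H2]; split.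
- by move=> x; apply: le_trans (ler_normD _ _) _; exact: lerD.
- by move=> x; exact: cvgD (H1 x) (H2 x).
- by move=> x; apply: le_trans (ler_normD _ _) _; exact: lerD.
case: H1 => h1' d1 t1; case: H2 => h2' d2 t2.
exists (fun x => h1' x + h2' x); first by move=> x; exact: is_deriveD.
under eq_fun do rewrite mulrDr.
exact: IH.
Qed.

(** By the Leibniz rule the derivative has majorant [s1 w1 w2 + w1 s2 w2], so the rates add, just as
    spectral supports add under convolution. *)
Lemma tameM n s1 s2 w1 w2 h1 h2 : tame n s1 w1 h1 -> tame n s2 w2 h2 ->
  tame n (s1 + s2) (fun x => w1 x * w2 x) (fun x => h1 x * h2 x).
Proof.
elim: n w1 w2 h1 h2 => [|n IH] w1 w2 h1 h2 t1 t2.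
  split; first by move=> x; rewrite normrM ler_pM// (tame_le t1, tame_le t2).
  move=> x; apply: cvgM.
    exact: (tame_continuous t1).
  exact: (tame_continuous t2).
have [s1t s2t] := (tameW t1, tameW t2).
split; first by move=> x; rewrite normrM ler_pM// (tame_le t1, tame_le t2).
case: t1 => _ [h1' d1 t1]; case: t2 => _ [h2' d2 t2].
exists (fun x => h1' x * h2 x + h1 x * h2' x).
  move=> x; apply: (is_derive_eq (is_derive_mul (d1 x) (d2 x))).
  by rewrite addrC (mulrC (h2 x)).
have -> : (fun x => (s1 + s2) * (w1 x * w2 x)) =
          (fun x => s1 * w1 x * w2 x + w1 x * (s2 * w2 x)).
  by apply/funext => x; ring.
by apply: tameD; exact: IH.
Qed.

Lemma tame_shift n s w h (a : R) : tame n s w h ->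
  tame n s (fun x => w (x + a)) (fun x => h (x + a)).
Proof.
elim: n w h => [|n IH] w h [hw H]; split=> //.
- by move=> x; apply: continuous_comp; [exact: (cvgD cvg_id (cvg_cst _))|exact: H].
- case: H => h' dh th'; exists (fun x => h' (x + a)); last exact: (IH _ _ th').
  move=> x; have D : is_derive x 1 (+%R^~ a) (1 : R).
    by apply: is_derive_eq; rewrite addr0.
  have C := @is_derive1_comp _ h (+%R^~ a) x _ _ (dh (x + a)) D.
  by rewrite mulr1 in C; exact C.
Qed.

Lemma tame_cst n s (c : R) : 0 <= s -> tame n s (cst `|c|) (cst c).
Proof.
(* The derivative of a constant is zero, but its prescribed majorant is rescaled at each order;
   hence the claim for [cst 0] under any nonnegative [w]. *)
move=> s0; suff H m w : (forall x, 0 <= w x) -> tame m s w (cst 0).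
  case: n => [|n]; split=> //; first by move=> x; exact: cvg_cst.
  by exists (cst 0); [move=> x; exact: is_derive_cst|apply: H => x; rewrite mulr_ge0].
elim: m w => [|m IH] w w0; split => //.
- by move=> x; rewrite normr0.
- by move=> x; exact: cvg_cst.
- by move=> x; rewrite normr0.
- by exists (cst 0); [move=> x; exact: is_derive_cst|apply: IH => x; rewrite mulr_ge0].
Qed.

(** Writing the derivative as a phase shift by [pi / 2] keeps derivatives of every order inside one
    family of cosines, with no sines or signs to track. *)
Lemma is_derive_cos_affine (l b x : R) :
  is_derive x 1 (fun t => cos (l * t + b)) (l * cos (l * x + (b + pi / 2))).
Proof.
have -> : cos (l * x + (b + pi / 2)) = - sin (l * x + b).
  by rewrite addrA cosDpihalf.
have D : is_derive x 1 (fun t => l * t + b) l.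
  by apply: is_derive_eq; rewrite /GRing.scale/= ?(mulr1, mulr0, addr0, add0r).
have C := @is_derive1_comp _ _ (fun t => l * t + b) x _ _
  (is_derive_cos (l * x + b)) D.
by rewrite mulrC in C; exact C.
Qed.

Lemma tame_cos n (l b : R) : 0 <= l -> tame n l (cst 1) (fun t => cos (l * t + b)).
Proof.
move=> l0.
(* Differentiation multiplies the amplitude by [l], so the induction needs an arbitrary amplitude
   [c]. *)
suff H c : 0 <= c -> tame n l (cst c) (fun t => c * cos (l * t + b)).
  by have := H 1 ler01; under [X in tame _ _ _ X]eq_fun do rewrite mul1r.
have B (c' b' x : R) : 0 <= c' -> `|c' * cos (l * x + b')| <= c'.
  by move=> c0; rewrite normrM ger0_norm// ler_piMr// cos_max.
elim: n c b => [|n IH] c b c0; split; first by move=> x; exact: B.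
- apply: (@is_derive_continuous _
    (fun x => c * (l * cos (l * x + (b + pi / 2))))) => x.
  by apply: is_deriveZ; exact: is_derive_cos_affine.
- by move=> x; exact: B.
- exists (fun x => l * c * cos (l * x + (b + pi / 2))).
    move=> x; rewrite -mulrA mulrCA.
    by apply: is_deriveZ; exact: is_derive_cos_affine.
  have T := IH (l * c) (b + pi / 2) (mulr_ge0 l0 c0); exact T.
Qed.

Lemma tame_smooth s h : (forall n, exists w, tame n s w h) -> smooth h.
Proof.
(* Derivability of the n-th derivative is a statement about order [n.+1]. *)
move=> th n x; have {th} [w] := th n.+1.
elim: n w h => [|n IH] w h [_ [h' dh th']]; first by case: (dh x).
rewrite derive1Sn (_ : h^`()%classic = h'); first exact: IH th'.
by apply/funext => y; rewrite derive1E derive_val.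
Qed.

End tame_algebra.

(** * Vanishing of oscillatory integrals *)

Section oscillatory_integrals.
Context {R : realType}.
Local Notation mu := (@lebesgue_measure R).
Implicit Types f h : R -> R.

Let continuous_weight : continuous (fun x : R => (oneDsqr x)^-1).
Proof. have H := @continuous_oneDsqrV R; exact H. Qed.

Lemma integrable_oneDsqrV :
  mu.-integrable setT (EFin \o (fun x : R => (oneDsqr x)^-1)).
Proof.
apply/integrableP; split.
  have M := continuous_measurable_fun continuous_weight.
  by apply/measurable_EFinP; exact M.
under eq_integral => x _ do rewrite /= ger0_norm ?invr_ge0//.
rewrite ge0_symfun_integralT.
- by rewrite -set_itvcy integral0y_oneDsqr -EFinM ltry.
- by move=> x; rewrite invr_ge0.
- exact: continuous_weight.
- by move=> x; rewrite /= /oneDsqr sqrrN.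
Qed.

Lemma dominated_integrable_oneDsqrV f (C : R) : continuous f ->
  (forall x, `|f x| <= C * (oneDsqr x)^-1) -> mu.-integrable setT (EFin \o f).
Proof.
move=> cf fC.
apply: (@le_integrable _ _ _ mu setT measurableT _
  (EFin \o (fun x => C * (oneDsqr x)^-1))).
- by have M := continuous_measurable_fun cf; apply/measurable_EFinP; exact M.
- by move=> x _ /=; rewrite lee_fin (le_trans (fC x))// ler_norm.
- have H := @integrableZl _ _ _ mu setT measurableT C _ integrable_oneDsqrV.
  by apply: eq_integrable H => // x _; rewrite /= EFinM.
Qed.

(** The fundamental theorem of calculus on growing symmetric intervals leaves only boundary values
    of [F], which tend to 0; dominated convergence passes to the whole line. *)
Lemma Rintegral_is_derive_eq0 (F f : R -> R) (C : R) :
  (forall x : R, is_derive x (1 : R) F (f x)) -> continuous f ->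
  (forall x, `|F x| <= C * (oneDsqr x)^-1) ->
  (forall x, `|f x| <= C * (oneDsqr x)^-1) ->
  \int[mu]_x f x = 0.
Proof.
move=> dF cf FC fC.
have intf := dominated_integrable_oneDsqrV cf fC.
pose q (x : R) := C * (oneDsqr x)^-1.
have intC : mu.-integrable setT (EFin \o q).
  apply: (@dominated_integrable_oneDsqrV _ `|C|).
    by move=> x; apply: cvgM; [exact: cvg_cst|exact: continuous_weight].
  by move=> x; rewrite /q normrM [X in _ * X]ger0_norm ?invr_ge0.
have mf : measurable_fun setT f by exact: continuous_measurable_fun.
(* The successor keeps the interval nondegenerate at [n = 0] and makes the reciprocal of its right
   endpoint the harmonic sequence used below. *)
pose I n : set R := `[- n.+1%:R, n.+1%:R]%classic.
pose f_ n := EFin \o (f \_ (I n)).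
have C0 : 0 <= C.
  by have := le_trans (normr_ge0 _) (FC 0);
    rewrite /oneDsqr expr0n addr0 invr1 mulr1.
have f_E n : (\int[mu]_x f_ n x)%E = (F n.+1%:R - F (- n.+1%:R))%R%:E.
  rewrite EFinB -(@continuous_FTC2 _ f F).
  - by rewrite [RHS]integral_mkcond restrict_EFin.
  - by rewrite gtrN.
  - exact: continuous_subspaceT.
  - have cF : continuous F by exact: is_derive_continuous dF.
    split.
    + by move=> x _; exact: ex_derive.
    + by apply: cvg_at_right_filter; exact: cF.
    + by apply: cvg_at_left_filter; exact: cF.
  - by move=> x _; rewrite derive1E derive_val.
have mf_ n : measurable_fun setT (f_ n).
  apply/measurable_EFinP; apply/(measurable_restrictT f (measurable_itv _)).
  exact: measurable_funTS.
have f_f : {ae mu, forall x, setT x -> f_ ^~ x @ \oo --> (EFin \o f) x}.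
  apply: aeW => x _; apply: cvg_near_cst.
  apply: filterS (nbhs_infty_ger `|x|) => n xn.
  rewrite /f_ /= patchE mem_set// /I /= in_itv/= -ler_norml.
  by rewrite (le_trans xn)// ler_nat.
have f_C : {ae mu, forall x n, setT x -> (`|f_ n x| <= (EFin \o q) x)%E}.
  apply: aeW => x n _; rewrite lee_fin patchE; case: ifPn => // _.
  by rewrite normr0 (le_trans _ (fC x)).
have [_ _ H] := @dominated_convergence _ _ _ mu setT measurableT f_ (EFin \o f)
  (EFin \o q) mf_ (measurable_int _ intf) f_f intC f_C.
suff : (\int[mu]_x (EFin \o f) x = 0)%E by rewrite /Rintegral => ->.
apply: cvg_unique H _ => //.
rewrite (_ : [sequence _]_n =
  EFin \o (fun n => F n.+1%:R - F (- n.+1%:R))%R); last exact/funext.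
apply: cvg_EFin; first exact: nearW.
apply: norm_cvg0.
apply: (@squeeze_cvgr _ _ _ _ (cst 0) (fun n => (2 * C) * n.+1%:R^-1)).
- apply: nearW => n; rewrite /= normr_ge0/=.
  have n1 : 1 <= n.+1%:R :> R by rewrite ler1n.
  have le_inv : (oneDsqr n.+1%:R)^-1 <= n.+1%:R^-1 :> R.
    rewrite lef_pV2 ?posrE// /oneDsqr expr2; nra.
  rewrite (le_trans (ler_normB _ _))// mulr_natl mulr2n mulrDl.
  apply: lerD; first by rewrite (le_trans (FC _))// ler_wpM2l.
  by rewrite (le_trans (FC _))// {1}/oneDsqr sqrrN ler_wpM2l.
- exact: cvg_cst.
- rewrite -[X in _ --> X](mulr0 (2 * C)); apply: cvgM; first exact: cvg_cst.
  exact: cvg_harmonic.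
Qed.

Lemma Rintegral_tame_cos_le n (s l b C : R) h :
  0 <= s -> 0 < l ->
  tame n s (fun x => C * (oneDsqr x)^-1) h ->
  `|\int[mu]_x (h x * cos (l * x + b))| <=
    C * (s / l) ^+ n * \int[mu]_x (oneDsqr x)^-1.
Proof.
move=> s0 l0; have cc b' : continuous (fun x => cos (l * x + b')).
  exact: is_derive_continuous (is_derive_cos_affine l b').
have hcB (h' : R -> R) C' b' x : (forall x, `|h' x| <= C' * (oneDsqr x)^-1) ->
    `|h' x * cos (l * x + b')| <= C' * (oneDsqr x)^-1.
  move=> hC; rewrite normrM (le_trans _ (hC x))// ler_piMr//; exact: cos_max.
have ih (h' : R -> R) C' b' : continuous h' ->
    (forall x, `|h' x| <= C' * (oneDsqr x)^-1) ->
    mu.-integrable setT (EFin \o (fun x => h' x * cos (l * x + b'))).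
  move=> ch hC; apply: (@dominated_integrable_oneDsqrV _ C').
    by move=> x; apply: cvgM; [exact: ch|exact: cc].
  by move=> x; exact: hcB.
(* After one integration by parts, [h'] has constant [s * C] and the phase drops by [pi / 2], so
   [C], [b] and [h] must all vary. *)
elim: n C b h => [|n IH] C b h th.
  rewrite expr0 mulr1.
  have ch := tame_continuous th; have hC := tame_le th.
  rewrite (le_trans (le_normr_Rintegral _ (ih _ _ _ ch hC)))//.
  rewrite -RintegralZl//; last exact: integrable_oneDsqrV.
  apply: le_Rintegral => //.
  - apply: (@dominated_integrable_oneDsqrV _ C).
      move=> x; apply: (@cvg_comp _ _ _ (fun x => h x * cos (l * x + b)) Num.norm).
        by apply: cvgM; [exact: ch|exact: cc].
      exact: norm_continuous.
    by move=> x; rewrite normr_id; exact: hcB.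
  - apply: (@dominated_integrable_oneDsqrV _ `|C|).
      by move=> x; apply: cvgM; [exact: cvg_cst|exact: continuous_weight].
    by move=> x; rewrite normrM [X in _ * X]ger0_norm ?invr_ge0.
  - by move=> x _; exact: hcB.
have ch := tame_continuous th; have hC := tame_le th.
have C0 : 0 <= C.
  by have := le_trans (normr_ge0 _) (hC 0);
    rewrite /oneDsqr expr0n addr0 invr1 mulr1.
case: th => _ [h' dh th'].
have {}th' : tame n s (fun x => s * C * (oneDsqr x)^-1) h'.
  by under eq_fun do rewrite -mulrA.
have ch' := tame_continuous th'; have hC' := tame_le th'.
have bb : b - pi / 2 + pi / 2 = b by rewrite subrK.
(* Integration by parts: the integrand is the derivative of [h(x) sin(l x + b)], the sine being
   written as a cosine shifted by [- pi / 2]. *)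
have : \int[mu]_x (l * (h x * cos (l * x + b)) +
    h' x * cos (l * x + (b - pi / 2))) = 0.
  apply: (@Rintegral_is_derive_eq0 (fun x => h x * cos (l * x + (b - pi / 2)))
    (* One constant has to serve both the primitive, bounded with [C], and its derivative, bounded
       with [l * C + s * C]. *)
    _ (C + l * C + s * C)).
  - move=> x.
    have D := is_derive_mul (dh x) (is_derive_cos_affine l (b - pi / 2) x).
    by apply: (is_derive_eq D); rewrite bb mulrCA (mulrC (h' x)).
  - move=> x; apply: cvgD.
      by apply: cvgM; [exact: cvg_cst|apply: cvgM; [exact: ch|exact: cc]].
    by apply: cvgM; [exact: ch'|exact: cc].
  - move=> x; rewrite (le_trans (hcB _ _ _ _ hC))//.
    by rewrite ler_wpM2r ?invr_ge0// -addrA lerDl addr_ge0// mulr_ge0// ltW.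
  - move=> x; rewrite (le_trans (ler_normD _ _))// [leRHS]mulrDl.
    rewrite lerD//; last exact: hcB.
    apply: (@le_trans _ _ (l * C * (oneDsqr x)^-1)); last first.
      by rewrite ler_wpM2r ?invr_ge0// lerDr.
    by rewrite normrM gtr0_norm// -mulrA ler_wpM2l ?(ltW l0)//; apply: hcB hC.
rewrite RintegralD//; last exact: ih.
  rewrite RintegralZl//; last exact: ih.
  move=> /eqP; rewrite addr_eq0 => /eqP E.
  have -> : \int[mu]_x (h x * cos (l * x + b)) =
     - l^-1 * \int[mu]_x (h' x * cos (l * x + (b - pi / 2))).
    by rewrite mulNr -mulrN -E mulKf// gt_eqF.
  have H := IH _ (b - pi / 2) _ th'.
  rewrite normrM normrN (gtr0_norm (_ : 0 < l^-1)) ?invr_gt0//.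
  have := ler_wpM2l (ltW (_ : 0 < l^-1)) H.
  rewrite invr_gt0 => /(_ l0)/le_trans; apply.
  by rewrite exprS le_eqVlt; apply/orP; left; apply/eqP; ring.
apply: (@dominated_integrable_oneDsqrV _ (l * C)).
  by move=> x; apply: cvgM; [exact: cvg_cst|apply: cvgM; [exact: ch|exact: cc]].
by move=> x; rewrite normrM gtr0_norm// -mulrA ler_wpM2l ?(ltW l0)//; apply: hcB hC.
Qed.

(** The preceding bound holds for every [n], and [(s / l) ^+ n] tends to 0. *)
Lemma Rintegral_tame_cos_eq0 (s l b C : R) h :
  0 <= s < l -> (forall n, tame n s (fun x => C * (oneDsqr x)^-1) h) ->
  \int[mu]_x (h x * cos (l * x + b)) = 0.
Proof.
move=> /andP[s0 sl] th; have l0 : 0 < l by exact: le_lt_trans sl.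
apply/eqP; rewrite -normr_le0.
have sl1 : `|s / l| < 1.
  by rewrite ger0_norm ?divr_ge0 ?(ltW l0)// ltr_pdivrMr// mul1r.
have H := @cvg_geometric R (C * \int[mu]_x (oneDsqr x)^-1) _ sl1.
rewrite -[leRHS](cvg_lim _ H)//; apply: limr_ge; first by apply/cvg_ex; exists 0.
apply: nearW => n; rewrite /geometric/=.
by rewrite mulrAC; exact: Rintegral_tame_cos_le.
Qed.

(** * Integrals against products of modulating factors do not see the phase *)

Lemma continuous_prod_cos (M th : R) (bs : seq R) :
  continuous (fun x => \prod_(b <- bs) (1 + cos (M * x + th + b))).
Proof.
elim: bs => [|b bs IH].
  by under eq_fun do rewrite big_nil; move=> x; exact: cvg_cst.
under eq_fun do rewrite big_cons; move=> x; apply: cvgM; last exact: IH.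
apply: cvgD; first exact: cvg_cst.
suff C : continuous (fun x => cos (M * x + th + b)) by exact: C.
have -> : (fun x => cos (M * x + th + b)) = (fun x => cos (M * x + (th + b))).
  by apply/funext => y; rewrite addrA.
exact: (is_derive_continuous (is_derive_cos_affine M (th + b))).
Qed.

Lemma prod_cos_le (bs : seq R) (u : R) :
  `|\prod_(b <- bs) (1 + cos (u + b))| <= 2 ^+ size bs.
Proof.
elim: bs => [|b bs IH]; first by rewrite big_nil normr1.
rewrite big_cons normrM exprS ler_pM//.
by rewrite (le_trans (ler_normD _ _))// normr1 -[leRHS]/(1 + 1) lerD2l cos_max.
Qed.

Lemma integrable_mul_trig (M C th : R) h (bs : seq R) (m : int) (c : R) :
  continuous h -> (forall x, `|h x| <= C * (oneDsqr x)^-1) ->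
  mu.-integrable setT (EFin \o (fun x => h x * (cos (m%:~R * (M * x + th) + c) *
    \prod_(b <- bs) (1 + cos (M * x + th + b))))).
Proof.
move=> ch hC; apply: (dominated_integrable_oneDsqrV (C := C * 2 ^+ size bs)).
  move=> x; apply: cvgM; first exact: ch.
  apply: cvgM; last exact: continuous_prod_cos.
  suff cc : continuous (fun y => cos (m%:~R * (M * y + th) + c)) by exact: cc.
  have -> : (fun y => cos (m%:~R * (M * y + th) + c)) =
            (fun y => cos (m%:~R * M * y + (m%:~R * th + c))).
    by apply/funext => y; rewrite mulrDr mulrA addrA.
  exact: (is_derive_continuous (is_derive_cos_affine _ _)).
move=> x; rewrite normrM mulrAC ler_pM//.
by rewrite normrM -[leRHS]mul1r ler_pM// ?cos_max// prod_cos_le.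
Qed.

Lemma cos_mul_cos (a b : R) :
  cos a * cos b = 2^-1 * cos (a + b) + 2^-1 * cos (a - b).
Proof. by rewrite cosD cosB; lra. Qed.

(* Induction on [bs], with arbitrary [m] and [c] because the product-to-sum
   formula turns the frequency [m] into [m], [m + 1] and [m - 1]. *)
Lemma Rintegral_tame_phase (M s C th : R) h (bs : seq R) (m : int) (c : R) :
  0 <= s < M -> (forall n, tame n s (fun x => C * (oneDsqr x)^-1) h) ->
  \int[mu]_x (h x * (cos (m%:~R * (M * x + th) + c) *
    \prod_(b <- bs) (1 + cos (M * x + th + b)))) =
  \int[mu]_x (h x * (cos (m%:~R * (M * x) + c) *
    \prod_(b <- bs) (1 + cos (M * x + b)))).
Proof.
(* The right-hand side is the case [th = 0] of the left, so both sides can be treated as instances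
   of one expression [T]. *)
move=> sM hh; suff {th} H th : \int[mu]_x (h x * (cos (m%:~R * (M * x + th) + c) *
    \prod_(b <- bs) (1 + cos (M * x + th + b)))) =
  \int[mu]_x (h x * (cos (m%:~R * (M * x + 0) + c) *
    \prod_(b <- bs) (1 + cos (M * x + 0 + b)))).
  rewrite H; congr Rintegral; by apply/funext => x; rewrite addr0.
have M0 : 0 < M by case/andP: sM => /le_lt_trans; apply.
pose T th bs (m : int) c x := h x * (cos (m%:~R * (M * x + th) + c) *
    \prod_(b <- bs) (1 + cos (M * x + th + b))).
have intT th' bs' m' c' : mu.-integrable setT (EFin \o T th' bs' m' c').
  by apply: integrable_mul_trig (tame_le (hh 0%N)); exact: tame_continuous (hh 0%N).
rewrite -/(T th bs m c) -/(T 0 bs m c).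
elim: bs m c th => [|b bs IH] m c th.
  (* A nonzero frequency has [|m| * M >= M > s], so both integrals vanish; at [m = 0] the phase has
     disappeared from the integrand. For negative [m], evenness of the cosine makes the frequency
     positive. *)
  have T0 th' : m != 0 -> \int[mu]_x T th' [::] m c x = 0.
    move=> m0; have [mneg|mpos] := ltP m 0.
      rewrite -(@Rintegral_tame_cos_eq0 s (- m%:~R * M) (- m%:~R * th' - c) C h) //.
        apply: eq_Rintegral => x _; rewrite /T big_nil mulr1 -[in RHS]cosN.
        by congr (_ * cos _); ring.
      case/andP: sM => -> /lt_le_trans -> //; rewrite ler_peMl ?(ltW M0)//.
      by rewrite -intrN ler1z -gtz0_ge1 oppr_gt0.
    rewrite -(@Rintegral_tame_cos_eq0 s (m%:~R * M) (m%:~R * th' + c) C h) //.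
      apply: eq_Rintegral => x _; rewrite /T big_nil mulr1.
      by congr (_ * cos _); ring.
    case/andP: sM => -> /lt_le_trans -> //; rewrite ler_peMl ?(ltW M0)//.
    by rewrite ler1z -gtz0_ge1 lt_neqAle eq_sym m0.
  have [->|m0] := eqVneq m 0; last by rewrite !T0.
  by apply: eq_Rintegral => x _; rewrite /T !big_nil !mul0r.
have intZ (g : R -> R) : mu.-integrable setT (EFin \o g) ->
    mu.-integrable setT (EFin \o (fun x => 2^-1 * g x)).
  move=> ig; have H := @integrableZl _ _ _ mu setT measurableT 2^-1 _ ig.
  by apply: eq_integrable H => // x _; rewrite /= EFinM.
have step th' : \int[mu]_x T th' (b :: bs) m c x = \int[mu]_x T th' bs m c x +
   (2^-1 * \int[mu]_x T th' bs (m + 1) (c + b) x +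
    2^-1 * \int[mu]_x T th' bs (m - 1) (c - b) x).
  rewrite -!RintegralZl// -RintegralD//.
  rewrite -RintegralD//.
    apply: eq_Rintegral => x _; rewrite /T big_cons.
    have -> : (m + 1)%:~R * (M * x + th') + (c + b) =
        m%:~R * (M * x + th') + c + (M * x + th' + b).
      by rewrite intrD; ring.
    have -> : (m - 1)%:~R * (M * x + th') + (c - b) =
        m%:~R * (M * x + th') + c - (M * x + th' + b).
      by rewrite intrB; ring.
    have := cos_mul_cos (m%:~R * (M * x + th') + c) (M * x + th' + b).
    set p := \prod_(_ <- _) _; set A := cos _; set B := cos _.
    set D := cos _; set E := cos _.
    move=> AB; rewrite (_ : A * ((1 + B) * p) = A * p + A * B * p); last by ring.
    by rewrite AB; ring.
  - have H := @integrableD _ _ _ mu setT measurableT _ _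
      (intZ _ (intT th' bs (m + 1) (c + b)))
      (intZ _ (intT th' bs (m - 1) (c - b))).
    by apply: eq_integrable H => // x _; rewrite /= EFinD.
  - exact: intZ.
  - exact: intZ.
by rewrite !step (IH m c th) (IH (m + 1)) (IH (m - 1)).
Qed.
End oscillatory_integrals.

(** * The function sin t / t, its derivatives and their decay *)

Section sinc.
Context {R : realType}.
Local Notation mu := (@lebesgue_measure R).

(* The j-th derivative of sin t / t, the integral of cos(s t) over s in [0, 1]. *)
Definition sinc_derive (j : nat) (t : R) : R :=
  \int[mu]_(s in `[0, 1]) (s ^+ j * cos (s * t + j%:R * (pi / 2))).
Local Notation S := sinc_derive.

Let continuous_integrand j (t c : R) :
  continuous (fun s : R => s ^+ j * cos (s * t + c)).
Proof.
move=> s; apply: cvgM; first exact: exprn_continuous.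
suff cc : continuous (fun s : R => cos (s * t + c)) by exact: cc.
have -> : (fun s : R => cos (s * t + c)) = (fun s : R => cos (t * s + c)).
  by apply/funext => x; rewrite mulrC.
exact: (is_derive_continuous (is_derive_cos_affine _ _)).
Qed.

Let integrable_integrand j (t c : R) :
  mu.-integrable `[0, 1] (EFin \o (fun s : R => s ^+ j * cos (s * t + c))).
Proof.
apply: continuous_compact_integrable; first exact: segment_compact.
exact/continuous_subspaceT/continuous_integrand.
Qed.

Let integrand_le j (t c s : R) :
  `[0, 1]%classic s -> `|s ^+ j * cos (s * t + c)| <= 1.
Proof.
rewrite /= in_itv/= => /andP[s0 s1].
by rewrite normrM -[leRHS]mul1r ler_pM ?cos_max// ger0_norm ?exprn_ge0// exprn_ile1.
Qed.

Let integrable_cst1 : mu.-integrable `[0, 1] (EFin \o (fun _ : R => 1 : R)).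
Proof.
apply: continuous_compact_integrable; first exact: segment_compact.
by apply: continuous_subspaceT => x; exact: cvg_cst.
Qed.

Let Rintegral_cst1 : \int[mu]_(s in `[0, 1]) (1 : R) = 1.
Proof.
rewrite Rintegral_cst; last exact: measurable_itv.
have E : mu `[0 : R, 1] = 1%E.
  by rewrite lebesgue_measure_itv/= lte_fin ltr01 oppr0 adde0.
by rewrite mul1r; exact: (congr1 fine E).
Qed.

Lemma sinc_derive_le1 j t : `|S j t| <= 1.
Proof.
rewrite -[leRHS]Rintegral_cst1.
rewrite (le_trans (le_normr_Rintegral _ (integrable_integrand _ _ _)))//.
apply: le_Rintegral => //.
  apply: continuous_compact_integrable; first exact: segment_compact.
  apply: continuous_subspaceT => x.
  apply: (@cvg_comp _ _ _
    (fun s : R => s ^+ j * cos (s * t + j%:R * (pi / 2))) Num.norm).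
    exact: continuous_integrand.
  exact: norm_continuous.
by move=> x x01; exact: integrand_le.
Qed.

(** Differentiation under the integral sign, the differentiated integrand being bounded by 1 on
    [[0, 1]]. The unit neighbourhood of [t] is arbitrary, since this bound is uniform. *)
Lemma is_derive_sinc_derive j (t : R) : is_derive t 1 (S j) (S j.+1 t).
Proof.
pose f (t s : R) := s ^+ j * cos (s * t + j%:R * (pi / 2)).
have df (u s : R) : is_derive u 1 (f ^~ s)
    (s ^+ j.+1 * cos (s * u + j.+1%:R * (pi / 2))).
  have D := is_deriveZ (s ^+ j) (is_derive_cos_affine s (j%:R * (pi / 2)) u).
  have -> : j.+1%:R * (pi / 2) = j%:R * (pi / 2) + pi / 2 :> R.
    by rewrite -natr1 mulrDl mul1r.
  by apply: (is_derive_eq D); rewrite exprSr -mulrA.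
have pf s u : partial1of2 f u s = s ^+ j.+1 * cos (s * u + j.+1%:R * (pi / 2)).
  by rewrite partial1of2E; exact: derive_val.
have It : `]t - 1, t + 1[%classic t.
  by rewrite /= in_itv/= ltrBlDr ltrDl ltr01.
have G_ub : forall x y, `]t - 1, t + 1[%classic x -> `[0, 1]%classic y ->
    `|partial1of2 f x y| <= (cst 1 : R -> R) y.
  by move=> x y _ y01; rewrite pf; exact: integrand_le.
have derf : forall x y, `]t - 1, t + 1[%classic x -> `[0, 1]%classic y ->
    derivable (f ^~ y) x 1.
  by move=> x y _ _; case: (df x y).
have intf x : `]t - 1, t + 1[%classic x -> mu.-integrable `[0, 1] (EFin \o f x).
  by move=> _; exact: integrable_integrand.
apply: DeriveDef.
  exact: (@derivable_under_integral R _ _ mu f `[0, 1] (measurable_itv _)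
    t (t - 1) (t + 1) It intf derf (cst 1) (fun _ => ler01) integrable_cst1 G_ub).
rewrite -derive1E.
rewrite (@differentiation_under_integral R _ _ mu f `[0, 1] (measurable_itv _)
    t (t - 1) (t + 1) It intf derf (cst 1) (fun _ => ler01) integrable_cst1 G_ub).
by apply: eq_Rintegral => s _; exact: pf.
Qed.

(** In [s], the integrand [t cos(s t)] has primitive [sin(s t)]. The product form covers [t = 0]
    without a case distinction. *)
Lemma sinc0E (t : R) : t * S 0 t = sin t.
Proof.
rewrite /sinc_derive -RintegralZl//.
pose F s := sin (s * t).
have dF (s : R) : is_derive s 1 F (t * cos (s * t)).
  have D : is_derive s 1 ( *%R^~ t) t.
    by apply: is_derive_eq; rewrite /GRing.scale/= ?(mulr1, mulr0, addr0, add0r).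
  have C := @is_derive1_comp _ _ ( *%R^~ t) s _ _ (is_derive_sin (s * t)) D.
  by rewrite mulrC in C; exact C.
rewrite /Rintegral.
under eq_integral do rewrite expr0 mul1r mul0r addr0.
have cF : continuous F by exact: is_derive_continuous dF.
rewrite (@continuous_FTC2 _ (fun s => t * cos (s * t)) F)//.
- by rewrite /F mul1r mul0r sin0 sube0.
- apply: continuous_subspaceT => x; apply: cvgM; first exact: cvg_cst.
  have := @continuous_integrand 0 t 0 x.
  by under eq_fun do rewrite expr0 mul1r addr0.
- split.
  + by move=> x _; exact: ex_derive.
  + by apply: cvg_at_right_filter; exact: cF.
  + by apply: cvg_at_left_filter; exact: cF.
- by move=> x _; rewrite derive1E derive_val.
Qed.

(* The (j + 1)-th derivative of t * sinc t = sin t. *)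
Lemma sinc_derive_rec j (t : R) :
  t * S j.+1 t + j.+1%:R * S j t = cos (t + j%:R * (pi / 2)).
Proof.
elim: j t => [|j IH] t.
  have D := is_derive_mul (is_derive_id t 1) (is_derive_sinc_derive 0 t).
  have E : is_derive t 1 sin (t * S 1 t + S 0 t *: 1).
    rewrite (_ : sin = (fun t => t * S 0 t)); last first.
      by apply/funext => x; rewrite sinc0E.
    by apply: (is_derive_eq D).
  have := @derive_val _ _ _ _ _ _ _ E.
  rewrite (@derive_val _ _ _ _ _ _ _ (is_derive_sin t)).
  by rewrite mul0r addr0 mul1r /GRing.scale/= mulr1.
(* Both sides of the induction hypothesis are differentiated in [t], and the two derivatives
   identified by uniqueness. *)
have D := is_derive_mul (is_derive_id t 1) (is_derive_sinc_derive j.+1 t).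
have D' := is_deriveD D (is_deriveZ j.+1%:R (is_derive_sinc_derive j t)).
have E := is_derive_cos_affine 1 (j%:R * (pi / 2)) t.
have eqf : (fun x => cos (1 * x + j%:R * (pi / 2))) =
    (fun x => x * S j.+1 x) + (j.+1%:R \*: S j).
  by apply/funext => x; rewrite mul1r -IH.
rewrite eqf in E.
have := @derive_val _ _ _ _ _ _ _ E; rewrite (@derive_val _ _ _ _ _ _ _ D').
rewrite !mul1r /GRing.scale/= mulr1 -(natr1 j) (mulrDl j%:R 1 (pi / 2)) mul1r => <-.
by rewrite -!natr1; ring.
Qed.

(* The factor 2 ^+ j is crude (a constant would do); it only makes M larger. *)
Lemma sinc_derive_decay j t : `|S j t| <= 2 ^+ j * (2 / (1 + `|t|)).
Proof.
have t0 : 0 < 1 + `|t| by rewrite ltr_pwDl.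
rewrite mulrA ler_pdivlMr// mulrDr mulr1.
have h1 := sinc_derive_le1 j t.
(* The recurrence expresses [t * S j t] through a cosine and [j] times the previous derivative, each
   factor being at most 1 in absolute value. *)
have h2 : `|S j t| * `|t| <= 1 + j%:R.
  rewrite -normrM mulrC; case: j h1 => [|j] h1.
    by rewrite sinc0E addr0 sin_max.
  have -> : t * S j.+1 t = cos (t + j%:R * (pi / 2)) - j.+1%:R * S j t.
    by rewrite -sinc_derive_rec addrK.
  rewrite (le_trans (ler_normB _ _))// lerD ?cos_max// normrM normr_nat.
  by rewrite ler_piMr// sinc_derive_le1.
have h3 : 2 + j%:R <= 2 ^+ j * 2 :> R.
  rewrite -exprSr -natrX -natrD ler_nat.
  by elim: (j) => // i IH; rewrite expnS; lia.
by rewrite (le_trans (lerD h1 h2))// addrA.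
Qed.

(** The rate 2 is the ratio of consecutive decay bounds [2 ^+ j]; the actual spectrum of sin t / t
    is [[-1, 1]]. *)
Lemma tame_sinc n j : tame n 2 (fun t => 2 ^+ j * (2 / (1 + `|t|))) (S j).
Proof.
elim: n j => [|n IH] j; split; try exact: sinc_derive_decay.
  exact: is_derive_continuous (is_derive_sinc_derive j).
exists (S j.+1); first exact: is_derive_sinc_derive.
by have := IH j.+1; under eq_fun do rewrite exprS -mulrA.
Qed.

Lemma sinc0N t : S 0 (- t) = S 0 t.
Proof. by apply: eq_Rintegral => s _; rewrite mulrN !mul0r !addr0 cosN. Qed.

Lemma sinc00 : S 0 0 = 1.
Proof.
rewrite -[RHS]Rintegral_cst1; apply: eq_Rintegral => s _.
by rewrite mulr0 mul0r addr0 cos0 mulr1 expr0.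
Qed.

End sinc.

(** * The modulated functions and their decks *)

Section counterexample.
Context {R : realType}.
Local Notation mu := (@lebesgue_measure R).

(** If the functions differ at a point, by continuity they differ on a ball around it, which has
    positive measure yet lies in a null set. *)
Lemma ae_eq_continuous (f g : R -> R) : continuous f -> continuous g ->
  {ae mu, forall x, f x = g x} -> f =1 g.
Proof.
move=> cf cg [N [mN N0 sub]] x; apply/eqP; apply: contrapT => /negP fgx.
have : \forall y \near x, f y - g y != 0.
  apply: (@cvgr_neq0 _ _ _ (nbhs x) _ (fun y => f y - g y) (f x - g x)).
    by apply: cvgB; [exact: cf|exact: cg].
  by rewrite subr_eq0.
move=> [e /= e0 ball_sub].
have : (mu (ball x e) <= mu N)%E.
  apply: le_measure; rewrite ?inE//; first exact: measurable_ball.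
  by move=> y /ball_sub /=; rewrite subr_eq0 => /eqP fgy; apply: sub.
by rewrite N0 lebesgue_measure_ball ?(ltW e0)// lee_fin leNgt mulrn_wgt0.
Qed.

(** Squaring gives both nonnegativity and the integrable decay [1 / t ^+ 2]. *)
Definition sinc2 (t : R) : R := sinc_derive 0 t * sinc_derive 0 t.

Definition modulated_sinc2 (M th t : R) : R := sinc2 t * (1 + cos (M * t + th)).

(** The rates add to [2 + 2], and [(1 + |t|) ^+ 2 >= 1 + t ^+ 2] turns the squared majorant into the
    integrable weight. *)
Lemma tame_sinc2 n : tame n 4 (fun t => 4 * (oneDsqr t)^-1) sinc2.
Proof.
have T := tameM (@tame_sinc R n 0) (@tame_sinc R n 0).
apply: (tame_weaken _ _ T); first by apply/andP; split => //; lra.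
move=> t /=; have t0 : 0 < (1 + `|t|) * (1 + `|t|) by rewrite mulr_gt0// ltr_pwDl.
rewrite expr0 mul1r mulrACA -invfM -natrM ler_wpM2l// lef_pV2 ?posrE//.
by rewrite /oneDsqr -real_normK ?num_real//; have := normr_ge0 t; nra.
Qed.

(** A constant majorant suffices for the shifted factors: in the deck, the unshifted factor provides
    the decay, uniformly in the shifts. *)
Lemma tame_prod_sinc2 n (xs : seq R) :
  tame n (4 * (size xs)%:R) (cst (4 ^+ size xs))
    (fun t => \prod_(x <- xs) sinc2 (t + x)).
Proof.
elim: xs => [|x xs IH].
  under eq_fun do rewrite big_nil.
  by have := @tame_cst R n 0 1 (lexx 0); rewrite mulr0 normr1 expr0.
under eq_fun do rewrite big_cons.
have T := tame_shift x (tame_sinc2 n).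
have {}T : tame n 4 (cst 4) (fun t => sinc2 (t + x)).
  apply: (tame_weaken _ _ T) => [|t /=]; first by rewrite ler0n lexx.
  by rewrite -[leRHS]mulr1 ler_wpM2l// invf_le1.
have := tameM T IH; rewrite /= -(natr1 (size xs)) mulrDr mulr1 addrC.
rewrite (_ : cst (4 ^+ _.+1) = (fun=> 4 * 4 ^+ size xs))//.
by apply/funext => t; rewrite /= exprS.
Qed.

Lemma tame_deck n (xs : seq R) :
  tame n (4 * (size xs).+1%:R) (fun t => 4 ^+ (size xs).+1 * (oneDsqr t)^-1)
    (fun t => sinc2 t * \prod_(x <- xs) sinc2 (t + x)).
Proof.
have := tameM (tame_sinc2 n) (tame_prod_sinc2 n xs).
rewrite -(natr1 (size xs)) mulrDr mulr1 addrC.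
rewrite (_ : (fun _ => 4 ^+ _.+1 / _) =
  (fun t => 4 / oneDsqr t * 4 ^+ size xs))//.
by apply/funext => t; rewrite /= exprS mulrAC.
Qed.

Lemma tame_modulated_sinc2 n (M th : R) : 0 <= M ->
  tame n (4 + M) (fun t => 8 * (oneDsqr t)^-1) (modulated_sinc2 M th).
Proof.
move=> M0; have := tameM (tame_sinc2 n)
  (tameD (tame_cst n 1 M0) (tame_cos n th M0)).
rewrite (_ : (fun t => 8 / _) =
  (fun t => 4 / oneDsqr t * (cst `|1| t + cst 1 t)))//.
by apply/funext => t; rewrite /= normr1; lra.
Qed.

Lemma modulated_sinc2_ge0 (M th t : R) : 0 <= modulated_sinc2 M th t.
Proof.
by apply: mulr_ge0; [rewrite /sinc2 -expr2 sqr_ge0|rewrite -lerBlDl sub0r cos_geN1].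
Qed.

(* The trivial factor cos 0 puts the deck in the shape of
   [Rintegral_tame_phase]. *)
Lemma k_deck_modulated_sinc2 (k : nat) (M th : R)
    (x : (k.-1).-tuple (measurableTypeR R)) :
  k_deck (modulated_sinc2 M th) x =
  (\int[mu]_t (sinc2 t * \prod_(y <- x) sinc2 (t + y) *
    (cos (0%:~R * (M * t + th) + 0) *
     \prod_(b <- 0 :: [seq M * y | y <- x]) (1 + cos (M * t + th + b))))%R)%:E.
Proof.
have td := @tame_deck 0 x.
have I := integrable_mul_trig M th (0 :: [seq M * y | y <- x]) 0 0
  (tame_continuous td) (tame_le td).
(* Finiteness, valid here for every [x], allows passing from the extended real integral to the real
   one. *)
have F := integrable_fin_num measurableT I.
rewrite /Rintegral fineK//; apply: eq_integral => t _; congr (_%:E).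
rewrite mul0r addr0 cos0 mul1r big_cons big_map addr0 /modulated_sinc2.
rewrite -(big_tuple _ _ x xpredT
  (fun y => sinc2 (t + y) * (1 + cos (M * (t + y) + th)))).
rewrite big_split/= mulrACA; congr (_ * (_ * _)).
by apply: eq_bigr => y _; congr (1 + cos _); ring.
Qed.

Lemma k_deck_modulated_sinc2_phase (k : nat) (M th : R)
    (x : (k.-1).-tuple (measurableTypeR R)) :
  (0 < k)%N -> 4 * k%:R < M ->
  k_deck (modulated_sinc2 M th) x = k_deck (modulated_sinc2 M 0) x.
Proof.
(* The [k - 1] shifted factors and the unshifted one each contribute 4, for a total rate of [4 * k],
   below [M]. *)
move=> k0 kM; have sM : (0 : R) <= 4 * (size x).+1%:R < M.
  by rewrite size_tuple prednK// kM mulr_ge0.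
rewrite !k_deck_modulated_sinc2; congr (_%:E).
(* Both decks are brought to the same phase-free integral; the second use runs backwards, at phase
   0. *)
rewrite (Rintegral_tame_phase th _ 0 0 sM (fun n => @tame_deck n x)).
by rewrite -(Rintegral_tame_phase 0 _ 0 0 sM (fun n => @tame_deck n x)).
Qed.

(** * The two functions are not translates of each other *)

Lemma sqr_mul_sinc2 (t : R) : t ^+ 2 * sinc2 t = sin t ^+ 2.
Proof. by rewrite -sinc0E /sinc2 exprMn (expr2 (sinc_derive 0 t)). Qed.

Lemma modulated_sinc2_not_translate (M : R) :
  0 <= M -> ~ is_translate (modulated_sinc2 M 0) (modulated_sinc2 M pi).
Proof.
move=> M0 [a].
set f := modulated_sinc2 M 0; set g := modulated_sinc2 M pi => gf.
have cf : continuous f := tame_continuous (tame_modulated_sinc2 0 0 M0).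
have cg : continuous g := tame_continuous (tame_modulated_sinc2 0 pi M0).
have {gf} gfE : g =1 (fun x => f (x - a)).
  apply: ae_eq_continuous => //.
  exact: tame_continuous (tame_shift (- a) (tame_modulated_sinc2 0 0 M0)).
have sN t : sinc2 (- t) = sinc2 t by rewrite /sinc2 sinc0N.
have fN t : f (- t) = f t by rewrite /f /modulated_sinc2 sN mulrN !addr0 cosN.
have gN t : g (- t) = g t.
  by rewrite /g /modulated_sinc2 sN !cosDpi mulrN cosN.
(* Reflecting [g] about 0 amounts to reflecting [f] about [- a]; combined with the evenness of [f],
   this gives the period [2 * a]. *)
have per : periodic f (2 * a).
  move=> t; have := gN (t + a); rewrite !gfE addrK => <-.
  by rewrite -[LHS]fN; congr f; ring.
have f0 : f 0 = 2.
  by rewrite /f /modulated_sinc2 /sinc2 sinc00 mulr0 addr0 cos0 mulr1 mul1r.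
have fle t : t ^+ 2 * f t <= 2.
  rewrite /f /modulated_sinc2 mulrA sqr_mul_sinc2 -[leRHS]mul1r ler_pM ?sqr_ge0//.
  by rewrite -[leRHS]/(1 + 1) lerD2l cos_le1.
(* For [a = 0] the values at 0 clash: [f 0 = 2], whereas [1 + cos pi = 0] gives [g 0 = 0]. *)
have [a0|a0] := eqVneq a 0.
  have := gfE 0; rewrite a0 subr0 f0 /g /modulated_sinc2 mulr0 add0r cospi.
  by rewrite subrr mulr0; apply/eqP; rewrite eq_sym pnatr_eq0.
(* With [n] above [1 / |2 a|], the point [t = 2 a n] satisfies [|t| > 1], and [f t = f 0 = 2] by
   periodicity, contradicting [t ^+ 2 * f t <= 2]. *)
have [n _ /(_ n (leqnn n)) /= na] := nbhs_infty_gtr (`|2 * a|^-1).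
have := fle (0 + 2 * a *+ n); rewrite (periodicn per n 0) f0.
have t1 : 1 < `|2 * a *+ n|.
  rewrite normrMn -(mulr_natr `|2 * a|) -ltr_pdivrMl ?mulr1//.
  by rewrite normr_gt0 mulf_neq0.
by rewrite add0r -real_normK ?num_real//; nra.
Qed.

End counterexample.

Theorem theorem2p4 (R : realType) (k : nat) (hk : (3 <= k)%N) :
  exists f g : R -> R,
    [/\ (forall x, 0 <= f x) /\ (forall x, 0 <= g x),
        smooth f /\ smooth g,
        (@lebesgue_measure R).-integrable setT (EFin \o f) /\
        (@lebesgue_measure R).-integrable setT (EFin \o g),
        {ae lebesgue_tuple R k.-1, forall x, k_deck f x = k_deck g x} &
        ~ is_translate f g].
Proof.
(* Any [M] strictly above the rate [4 * k] of the product of [k] factors would do. *)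
pose M : R := 4 * k%:R + 1.
have M0 : 0 <= M by rewrite addr_ge0// mulr_ge0.
have sm th : smooth (modulated_sinc2 M th).
  by apply: tame_smooth => n; eexists; exact: tame_modulated_sinc2.
have int th : (@lebesgue_measure R).-integrable setT (EFin \o modulated_sinc2 M th).
  have T := tame_modulated_sinc2 0 th M0.
  exact: dominated_integrable_oneDsqrV (tame_continuous T) (tame_le T).
exists (modulated_sinc2 M 0), (modulated_sinc2 M pi); split => //.
- by split=> x; exact: modulated_sinc2_ge0.
(* For these functions the decks agree at every point. *)
- apply: aeW => x; rewrite [RHS]k_deck_modulated_sinc2_phase ?ltrDl//.
  exact: leq_trans hk.
- exact: modulated_sinc2_not_translate.
Qed.
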